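(* Let $\mathbb{F}$ be a field. There is a constant $c>0$ such that, with $S=c\cdot n^2$, the following holds: if there is a polynomial-time algorithm that, given a $2n\times 2n$ matrix with entries in $M_S(\mathbb{F})$, computes its Cayley determinant, then there is a polynomial-time algorithm that computes the permanent of $n\times n$ matrices over $\mathbb{F}$.
   Context: For a matrix $B$ with entries from a (possibly noncommutative) ring, the $n\times n$ Cayley determinant is $\mathrm{Cdet}_n(B)=\sum_{\sigma\in S_n}\mathrm{sgn}(\sigma)\,B(1,\sigma(1))B(2,\sigma(2))\cdots B(n,\sigma(n))$, with products taken in row order. $M_S(\mathbb{F})$ denotes the ring of $S\times S$ matrices over $\mathbb{F}$. *)

(* Defs.v *)
From HB Require Import structures.
From mathcomp Require Import all_boot all_order all_fingroup all_algebra.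

Set Implicit Arguments.
Unset Strict Implicit.
Unset Printing Implicit Defensive.

Import GRing.Theory.

Local Open Scope ring_scope.

(* The (-1) ^+ s is the sign of s; \prod_(i < n) multiplies the factors from
   left to right in increasing order of i, i.e. in row order. *)
Definition Cdet (R : pzRingType) (n : nat) (B : 'M[R]_n) : R :=
  \sum_(s : 'S_n) (-1) ^+ s * \prod_(i < n) B i (s i).

Definition permanent (R : comPzRingType) (n : nat) (A : 'M[R]_n) : R :=
  \sum_(s : 'S_n) \prod_(i < n) A i (s i).

(* Algorithms over an arbitrary field F are programs for an algebraic random
   access machine.  It has natural-number registers, used for control and for
   addressing, and an unbounded memory of elements of F.  It may use finitely
   many constants of F, the field operations (with 0^-1 = 0), and tests for
   zero.  Registers can be added and (truncatedly) subtracted but not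
   multiplied, so that charging unit cost for register operations gives no
   more than polynomial speed-up. *)
Inductive nexp : Type :=
  | NConst of nat
  | NReg of nat
  | NAdd of nexp & nexp
  | NSub of nexp & nexp.

Inductive fexp (F : Type) : Type :=
  | FConst of F
  | FMem of nexp
  | FAdd of fexp F & fexp F
  | FOpp of fexp F
  | FMul of fexp F & fexp F
  | FInv of fexp F.

Inductive bexp (F : Type) : Type :=
  | BLt of nexp & nexp
  | BZero of fexp F
  | BNot of bexp F.

Inductive cmd (F : Type) : Type :=
  | Skip
  | SetReg of nat & nexp
  | SetMem of nexp & fexp F
  | Seq of cmd F & cmd F
  | If of bexp F & cmd F & cmd F
  | While of bexp F & cmd F.

Arguments FMem {F}.
Arguments BLt {F}.
Arguments Skip {F}.
Arguments SetReg {F}.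

Record state (F : Type) : Type := State { reg : nat -> nat; mem : nat -> F }.

Fixpoint neval (F : Type) (s : state F) (e : nexp) : nat :=
  match e with
  | NConst m => m
  | NReg r => reg s r
  | NAdd e1 e2 => neval s e1 + neval s e2
  | NSub e1 e2 => neval s e1 - neval s e2
  end%N.

Fixpoint feval (F : fieldType) (s : state F) (e : fexp F) : F :=
  match e with
  | FConst a => a
  | FMem i => mem s (neval s i)
  | FAdd e1 e2 => feval s e1 + feval s e2
  | FOpp e1 => - feval s e1
  | FMul e1 e2 => feval s e1 * feval s e2
  | FInv e1 => (feval s e1)^-1
  end.

Fixpoint beval (F : fieldType) (s : state F) (b : bexp F) : bool :=
  match b with
  | BLt e1 e2 => (neval s e1 < neval s e2)%N
  | BZero e => feval s e == 0
  | BNot b1 => ~~ beval s b1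
  end.

(* exec p s t s' : from state s, the program p halts in state s' after t steps.
   An assignment or a test is one step whatever the size of the expressions in
   it; for a fixed program this only matters up to a constant factor. *)
Inductive exec (F : fieldType) : cmd F -> state F -> nat -> state F -> Prop :=
  | ExecSkip s : exec Skip s 1 s
  | ExecSetReg r e s :
      exec (SetReg r e) s 1 (State [eta reg s with r |-> neval s e] (mem s))
  | ExecSetMem i e s :
      exec (SetMem i e) s 1
        (State (reg s) [eta mem s with neval s i |-> feval s e])
  | ExecSeq p q s t s1 u s2 :
      exec p s t s1 -> exec q s1 u s2 -> exec (Seq p q) s (t + u) s2
  | ExecIfTrue b p q s t s1 :
      beval s b -> exec p s t s1 -> exec (If b p q) s t.+1 s1
  | ExecIfFalse b p q s t s1 :
      ~~ beval s b -> exec q s t s1 -> exec (If b p q) s t.+1 s1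
  | ExecWhileTrue b p s t s1 u s2 :
      beval s b -> exec p s t s1 -> exec (While b p) s1 u s2 ->
      exec (While b p) s (t + u).+1 s2
  | ExecWhileFalse b p s :
      ~~ beval s b -> exec (While b p) s 1 s.

(* On an instance of parameter n, register 0 initially holds n, the code of the
   instance is at the start of the memory, and everything else is 0. *)
Definition init (F : fieldType) (n : nat) (w : seq F) : state F :=
  State [eta (fun=> 0%N) with 0%N |-> n] (nth 0 w).

(* f n is the function to be computed on instances of parameter n >= 1; a single
   program has to work for all n.  Its running time is polynomial in the number
   of field elements in the input: every polynomial in m with natural-number
   coefficients is bounded by m ^ k + k for some k.  The output is left at the
   start of the memory. *)
Definition polytime (F : fieldType) (I O : nat -> Type)
    (codeI : forall n, I n -> seq F) (codeO : forall n, O n -> seq F)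
    (f : forall n, I n -> O n) : Prop :=
  exists (p : cmd F) (k : nat), forall n : nat, (0 < n)%N -> forall x : I n,
  exists (t : nat) (s : state F),
    [/\ exec p (init n (codeI n x)) t s,
        (t <= size (codeI n x) ^ k + k)%N
      & forall i, (i < size (codeO n (f n x)))%N ->
          mem s i = nth 0 (codeO n (f n x)) i].

Definition scalar_code (F : Type) (a : F) : seq F := [:: a].

(* Row-major listing, given a code for the entries. *)
Definition mx_code (F T : Type) (code : T -> seq F) (n : nat) (A : 'M[T]_n) :
    seq F :=
  flatten [seq code (A i j) | i <- enum 'I_n, j <- enum 'I_n].

Definition permanent_polytime (F : fieldType) : Prop :=
  @polytime F (fun n => 'M[F]_n) (fun=> F)
    (fun n => @mx_code F F (@scalar_code F) n)
    (fun n => @scalar_code F)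
    (fun n A => permanent A).

(* The Cayley determinant of 2n x 2n matrices over M_(S n)(F). *)
Definition Cdet_polytime (F : fieldType) (S : nat -> nat) : Prop :=
  @polytime F (fun n => 'M['M[F]_(S n)]_(2 * n)) (fun n => 'M[F]_(S n))
    (fun n => @mx_code F 'M[F]_(S n) (@mx_code F F (@scalar_code F) (S n)) (2 * n))
    (fun n => @mx_code F F (@scalar_code F) (S n))
    (fun n B => Cdet B).

(* Main.v *)
Require Import Defs.
From Stdlib Require Import FunctionalExtensionality.
From mathcomp Require Import all_boot all_order all_fingroup all_algebra.
From mathcomp Require Import zify.

(* Given A, let B be the 2n x 2n matrix with blocks (rows and columns counted
   from 0) B(2i, 2j) = A(i, j) E_{0 j}, B(2i+1, 2j+1) = E_{j 0} and 0 elsewhere.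
   As products are taken in row order, the product of rows 2i and 2i+1 along t
   is A(i, j) E_{00} if t (2i) = 2j and t (2i+1) = 2j+1, and it vanishes if t is
   not of this form.  So only the permutations s that act in the same way on
   even and on odd indices survive.  These are even, hence Cdet B = per(A) E_{00};
   n <= n^2 dimensions suffice for the blocks, so c = 1.

   The code of B is mostly 0, and the entries of A are moved to their places
   within the memory in reverse order, which never overwrites an entry of A that
   has not been moved yet, because the new address is never smaller than the old
   one. *)

Set Implicit Arguments.
Unset Strict Implicit.
Unset Printing Implicit Defensive.

Import GRing.Theory.

Local Open Scope ring_scope.

(** * Runs of machine programs and their time bounds *)

Section Machine.
Variable F : fieldType.
Implicit Types (p q : cmd F) (s : state F) (rs : seq nat) (M : nat -> F).

(** Only an upper bound on the time is kept, so that the two branches of a test can share it. *)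
Definition runs p s s' (T : nat) : Prop := exists2 t, (t <= T)%N & exec p s t s'.

Lemma runs_le p s s' T T' : (T <= T')%N -> runs p s s' T -> runs p s s' T'.
Proof. by move=> leT [t let_]; exists t => //; apply: leq_trans leT. Qed.

Lemma runs_seq p q s s1 s2 T U :
  runs p s s1 T -> runs q s1 s2 U -> runs (Seq p q) s s2 (T + U).
Proof.
move=> [t let_ ep] [u leu eq]; exists (t + u)%N; first exact: leq_add.
exact: ExecSeq ep eq.
Qed.

(** The index of [st] is the number of iterations left, which matches counters that go down. *)
Lemma runs_while b p (st : nat -> state F) m T :
  (forall l, (l < m)%N -> beval (st l.+1) b) -> ~~ beval (st 0%N) b ->
  (forall l, (l < m)%N -> runs p (st l.+1) (st l) T) ->
  runs (While b p) (st m) (st 0%N) (m * T.+1 + 1).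
Proof.
move=> + b0; elim: m => [|m IHm] bS pS; first by exists 1%N => //; constructor.
have [||u leu eu] := IHm; [by move=> l /ltnW/bS | by move=> l /ltnW/pS |].
have [t let_ et] := pS m (ltnSn m).
exists (t + u).+1; first by lia.
by apply: ExecWhileTrue et eu; apply: bS.
Qed.

Definition listing rs M : state F := State (nth 0%N rs) M.

Lemma eq_listing rs rs' M M' :
  nth 0%N rs =1 nth 0%N rs' -> M =1 M' -> listing rs M = listing rs' M'.
Proof.
by move=> /functional_extensionality eq_r /functional_extensionality eq_M;
   rewrite /listing eq_r eq_M.
Qed.

Lemma runs_SetReg r e rs M :
  runs (SetReg r e) (listing rs M)
    (listing (set_nth 0%N rs r (neval (listing rs M) e)) M) 1.
Proof.
exists 1%N => //; have := ExecSetReg r e (listing rs M).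
congr (exec _ _ _ (State _ _)); apply: functional_extensionality => x.
by rewrite nth_set_nth.
Qed.

Lemma runs_SetMem i e rs M :
  runs (SetMem i e) (listing rs M)
    (listing rs [eta M with neval (listing rs M) i |-> feval (listing rs M) e]) 1.
Proof. by exists 1%N => //; apply: (ExecSetMem i e (listing rs M)). Qed.

Lemma runs_If b p q s s' T :
  (beval s b -> runs p s s' T) -> (~~ beval s b -> runs q s s' T) ->
  runs (If b p q) s s' T.+1.
Proof.
case: (boolP (beval s b)) => bs pq qr.
  by have [t let_ e] := pq isT; exists t.+1 => //; apply: ExecIfTrue.
by have [t let_ e] := qr isT; exists t.+1 => //; apply: ExecIfFalse.
Qed.

(** Registers cannot be multiplied, hence repeated addition; the counter [c] is used up. *)
Definition AddMul d a c : cmd F :=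
  While (BLt (NConst 0) (NReg c))
    (Seq (SetReg c (NSub (NReg c) (NConst 1)))
         (SetReg d (NAdd (NReg d) (NReg a)))).

Lemma runs_AddMul d a c rs M : d != c -> a != c -> a != d ->
  runs (AddMul d a c) (listing rs M)
    (listing (set_nth 0%N (set_nth 0%N rs c 0%N) d
       (nth 0 rs d + nth 0 rs c * nth 0 rs a)%N) M)
    (nth 0%N rs c * 3 + 1).
Proof.
move=> dc ac ad.
pose st l := listing (set_nth 0%N (set_nth 0%N rs c l) d
       (nth 0 rs d + (nth 0 rs c - l) * nth 0 rs a)%N) M.
have -> : listing rs M = st (nth 0%N rs c).
  apply: eq_listing => // x; rewrite subnn addn0 !nth_set_nth /= nth_set_nth /=.
  by case: eqP => [->|_] //; case: eqP => [->|].
have -> : (nth 0 rs c * nth 0 rs a = (nth 0 rs c - 0) * nth 0 rs a)%N by rewrite subn0.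
have ndc : (c == d) = false by rewrite eq_sym (negbTE dc).
apply: (runs_while (st := st)) => [l _||l lt_l].
- by rewrite /= nth_set_nth /= ndc nth_set_nth /= eqxx.
- by rewrite /= nth_set_nth /= ndc nth_set_nth /= eqxx.
apply: (@runs_seq _ _ _ _ _ 1 1); first exact: runs_SetReg.
have := runs_SetReg d (NAdd (NReg d) (NReg a)).
set rs1 := set_nth _ _ c _; move=> /(_ rs1 M).
congr (runs _ _ _ _); apply: eq_listing => // x.
rewrite /rs1 /= !nth_set_nth /= ?nth_set_nth /=.
rewrite (negbTE ac) (negbTE ad) (negbTE dc) eqxx ndc eqxx.
case: (eqVneq x d) => [_|/negbTE xd].
  by rewrite nth_set_nth /= (negbTE ac) -addnA -mulSnr subnSK.
case: (eqVneq x c) => [_|/negbTE xc]; first by rewrite subn1.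
by rewrite !nth_set_nth /= xd nth_set_nth /= xc.
Qed.

(* Sets register [d] to the product only if it holds 0. *)
Definition SetMul d a b c := Seq (SetReg c (NReg b)) (AddMul d a c).

End Machine.

(** * Moving entries within the memory in reverse order *)

Section Scatter.
Variables (F : fieldType) (a : nat -> F) (D E : nat -> nat) (N : nat).
Hypotheses (leD : forall k, (k <= D k)%N) (leE : forall k, (k <= E k)%N).

(* The memory when the sources [k < l] are still in place and every other [a k]
   has been moved to [D k], with a 1 added at [E k].  Since values are added
   rather than written, D and E need not be injective or disjoint. *)
Definition scatter (l x : nat) : F :=
  (if (x < l)%N then a x else 0)
  + \sum_(l <= k < N) (a k *+ (x == D k) + (x == E k)%:R).

(** Whatever has been moved so far went to places beyond [l]. *)
Lemma scatter_source l : scatter l.+1 l = a l.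
Proof.
rewrite /scatter ltnSn big_nat big1 ?addr0 // => k /andP[lt_lk _].
by rewrite !ltn_eqF ?mulr0n ?addr0 //; apply: leq_trans lt_lk _.
Qed.

(** The memory halfway through a step: [a l] has reached [D l], but the 1 is still to be added at
    [E l]. *)
Definition moved l x : F :=
  scatter l.+1 x - (a x *+ (x == l)) + a l *+ (x == D l).

Lemma scatter_step l x : (l < N)%N ->
  scatter l x = moved l x + (x == E l)%:R.
Proof.
move=> lt_lN; rewrite /moved /scatter (big_ltn lt_lN) (ltnS x l) (leq_eqVlt x l).
case: (ltngtP x l) => [lt_xl|lt_lx|->] /=; rewrite ?mulr1n ?mulr0n.
- by rewrite subr0 -!addrA; congr (_ + _); rewrite !addrA addrC addrA.
- by rewrite subr0 !add0r -[RHS]addrA addrC.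
by rewrite (addrAC (a l)) subrr !add0r -[RHS]addrA addrC.
Qed.

Lemma moved_lt l : (l < D l)%N ->
  moved l =1 [eta [eta scatter l.+1 with
     D l |-> scatter l.+1 (D l) + scatter l.+1 l] with l |-> 0].
Proof.
move=> lt_lD x; rewrite /moved /=.
case: (eqVneq x l) => [->|ne_xl].
  by rewrite scatter_source mulr1n subrr (ltn_eqF lt_lD) mulr0n addr0.
rewrite mulr0n subr0; case: eqP => [->|_]; last by rewrite addr0.
by rewrite scatter_source.
Qed.

(** Here [leD] forces [D l = l]: the entry is in place already, and clearing its source would lose
    it. *)
Lemma moved_ge l : ~~ (l < D l)%N -> moved l =1 scatter l.+1.
Proof.
rewrite -leqNgt => leDl x; rewrite /moved.
have -> : D l = l by apply/eqP; rewrite eqn_leq leDl leD.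
by case: eqP => [->|_]; rewrite ?mulr0n ?subr0 ?addr0 // subrK.
Qed.
End Scatter.

(** * Permutations acting alike on even and odd indices *)

Section DoubledPermutation.
Variable n : nat.
Implicit Types (i j : 'I_n) (r : 'I_(2 * n)) (s : 'S_n).

Lemma evenI_subproof i : (i.*2 < 2 * n)%N. Proof. by rewrite mul2n ltn_double. Qed.
Lemma oddI_subproof i : (i.*2.+1 < 2 * n)%N.
Proof. by rewrite mul2n ltn_Sdouble. Qed.
Lemma halfI_subproof r : (r./2 < n)%N.
Proof. by rewrite ltn_half_double -mul2n. Qed.

Definition evenI i := Ordinal (evenI_subproof i).
Definition oddI i := Ordinal (oddI_subproof i).
Definition halfI r := Ordinal (halfI_subproof r).

Lemma evenK : cancel evenI halfI.
Proof. by move=> i; apply: val_inj; rewrite /= doubleK. Qed.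
Lemma oddK : cancel oddI halfI.
Proof. by move=> i; apply: val_inj; rewrite /= uphalf_double. Qed.

Lemma odd_evenI i : odd (evenI i) = false. Proof. by rewrite /= odd_double. Qed.
Lemma odd_oddI i : odd (oddI i). Proof. by rewrite /= odd_double. Qed.

Lemma eq_evenI r : odd r = false -> r = evenI (halfI r).
Proof. by move=> ro; apply: val_inj; rewrite /= -[LHS]odd_double_half ro. Qed.
Lemma eq_oddI r : odd r -> r = oddI (halfI r).
Proof. by move=> ro; apply: val_inj; rewrite /= -[LHS]odd_double_half ro. Qed.

Variant parity_spec : 'I_(2 * n) -> Type :=
  | ParityEven i : parity_spec (evenI i)
  | ParityOdd i : parity_spec (oddI i).

Lemma parityP r : parity_spec r.
Proof.
by case ro: (odd r); [rewrite (eq_oddI ro) | rewrite (eq_evenI ro)]; constructor.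
Qed.

Definition even_act_fun s r := if odd r then r else evenI (s (halfI r)).

Lemma even_act_inj s : injective (even_act_fun s).
Proof.
move=> r r'; rewrite /even_act_fun.
case: (parityP r) => i; case: (parityP r') => j; rewrite ?odd_evenI ?odd_oddI.
- by rewrite !evenK => /(can_inj evenK)/perm_inj ->.
- by move/(congr1 (fun r : 'I_(2 * n) => odd r)); rewrite odd_evenI odd_oddI.
- by move/(congr1 (fun r : 'I_(2 * n) => odd r)); rewrite odd_evenI odd_oddI.
- by [].
Qed.

Definition even_act s := perm (@even_act_inj s).

Definition swap_fun r := if odd r then evenI (halfI r) else oddI (halfI r).

Lemma swap_inj : injective swap_fun.
Proof.
apply: (@can_inj _ _ _ swap_fun) => r; rewrite /swap_fun.
by case: (parityP r) => i; rewrite ?odd_evenI ?odd_oddI ?evenK ?oddK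
  ?odd_evenI ?odd_oddI ?evenK ?oddK.
Qed.

(* A product of two conjugate permutations, hence even. *)
Definition double_perm s : 'S_(2 * n) :=
  (even_act s * even_act s ^ perm swap_inj)%g.

Lemma even_act_even s i : even_act s (evenI i) = evenI (s i).
Proof. by rewrite permE /even_act_fun odd_evenI evenK. Qed.
Lemma even_act_odd s i : even_act s (oddI i) = oddI i.
Proof. by rewrite permE /even_act_fun odd_oddI. Qed.
Lemma swap_even i : perm swap_inj (evenI i) = oddI i.
Proof. by rewrite permE /swap_fun odd_evenI evenK. Qed.
Lemma swap_odd i : perm swap_inj (oddI i) = evenI i.
Proof. by rewrite permE /swap_fun odd_oddI oddK. Qed.

Lemma double_perm_even s i : double_perm s (evenI i) = evenI (s i).
Proof. by rewrite permM even_act_even -swap_odd permJ even_act_odd. Qed.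

Lemma double_perm_odd s i : double_perm s (oddI i) = oddI (s i).
Proof. by rewrite permM even_act_odd -swap_even permJ even_act_even swap_even. Qed.

Lemma double_perm_sign s : odd_perm (double_perm s) = false.
Proof. by rewrite odd_permM odd_permJ addbb. Qed.

Lemma double_perm_inj : injective double_perm.
Proof.
move=> s s' eq_ss'; apply/permP => i; apply: (can_inj evenK).
by rewrite -!double_perm_even eq_ss'.
Qed.

(** The halves of the even images give [s]: they are distinct because an even index is determined by
    its half. *)
Lemma double_permP (t : 'S_(2 * n)) :
  (forall i, ~~ odd (t (evenI i))) ->
  (forall i, t (oddI i) = oddI (halfI (t (evenI i)))) ->
  exists s, t = double_perm s.
Proof.
move=> t_even t_odd.
have t_evenE i : t (evenI i) = evenI (halfI (t (evenI i))).
  by apply: eq_evenI; apply: negbTE.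
have f_inj : injective (fun i => halfI (t (evenI i))).
  move=> i j eq_ij; apply: (can_inj evenK); apply: (@perm_inj _ t).
  by rewrite t_evenE eq_ij -t_evenE.
exists (perm f_inj); apply/permP => r; case: (parityP r) => i.
  by rewrite double_perm_even permE -t_evenE.
by rewrite double_perm_odd permE t_odd.
Qed.

(** Only neighbouring factors are grouped, so the order is kept and [R] may be noncommutative. *)
Lemma prod_pairs (R : pzSemiRingType) (f : 'I_(2 * n) -> R) :
  \prod_r f r = \prod_i (f (evenI i) * f (oddI i)).
Proof.
(* Extending [f] by 1 to all naturals frees the length of the product for induction. *)
pose g k := if insub k is Some r then f r else 1.
have gE r : f r = g r by rewrite /g valK.
rewrite (eq_bigr (fun r : 'I__ => g r)) => [|r _]; last exact: gE.
under [RHS]eq_bigr => i _ do rewrite !gE /=.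
rewrite -(big_mkord xpredT g) -(big_mkord xpredT (fun i : nat => g i.*2 * g i.*2.+1)).
elim: (n) => [|m IHm]; first by rewrite !big_geq.
by rewrite mulnS add2n !big_nat_recr //= IHm mul2n mulrA.
Qed.

End DoubledPermutation.

(** * The Cayley determinant of the block matrix *)

Section Reduction.
Variables (F : fieldType) (n S : nat).
Hypotheses (n_gt0 : (0 < n)%N) (le_nS : (n <= S)%N).
Variable A : 'M[F]_n.

Let toS : 'I_n -> 'I_S := widen_ord le_nS.
Let o : 'I_S := toS (Ordinal n_gt0).

Definition reduction_mx : 'M['M[F]_S]_(2 * n) :=
  \matrix_(r, c)
    if odd r (+) odd c then 0
    else if odd r then delta_mx (toS (halfI c)) o
    else A (halfI r) (halfI c) *: delta_mx o (toS (halfI c)).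

Let weight (i : 'I_n) (a b : 'I_(2 * n)) : F :=
  if ~~ odd a && (b == oddI (halfI a)) then A i (halfI a) else 0.

(** Mismatched parities give a zero factor; otherwise [E_{0j} E_{k0}] is [E_{00}] if [j = k] and 0
    if not. *)
Lemma reduction_mx_pair (i : 'I_n) (a b : 'I_(2 * n)) :
  reduction_mx (evenI i) a * reduction_mx (oddI i) b = weight i a b *: delta_mx o o.
Proof.
rewrite !mxE /weight odd_evenI odd_oddI evenK.
case: (parityP a) => j; rewrite ?odd_evenI ?odd_oddI ?scale0r ?mul0r //.
case: (parityP b) => k; rewrite ?odd_evenI ?odd_oddI ?evenK ?oddK.
  rewrite mulr0 (_ : (evenI k == oddI j) = false) ?scale0r //.
  apply: contraFF (odd_evenI k) => /eqP ->; exact: odd_oddI.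
rewrite -mulmxE -scalemxAl (inj_eq (can_inj (@oddK n))) mul_delta_mx_cond.
rewrite -val_eqE /= eq_sym val_eqE.
by case: eqP => _; rewrite ?mulr1n // mulr0n scaler0 scale0r.
Qed.

(** [E_{00}] is idempotent; [0 < m] excludes the empty product, which is the identity matrix. *)
Lemma prod_scale_delta m (f : 'I_m -> F) : (0 < m)%N ->
  \prod_i (f i *: delta_mx o o) = (\prod_i f i) *: delta_mx o o :> 'M[F]_S.
Proof.
elim: m f => // -[_|m IHm] f _; first by rewrite !big_ord_recl !big_ord0 !mulr1.
rewrite big_ord_recl IHm // [in RHS]big_ord_recl.
by rewrite -mulmxE -scalemxAl -scalemxAr scalerA mul_delta_mx.
Qed.

Lemma Cdet_reduction_mx : Cdet reduction_mx o o = permanent A.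
Proof.
have prodE (t : 'S_(2 * n)) : \prod_r reduction_mx r (t r) =
    (\prod_i weight i (t (evenI i)) (t (oddI i))) *: delta_mx o o.
  rewrite prod_pairs; under eq_bigr => i _ do rewrite reduction_mx_pair.
  exact: prod_scale_delta.
rewrite summxE /permanent.
rewrite (bigID (mem (@double_perm n @: setT))) /= addrC big1 ?add0r => [|t t_im].
  rewrite big_imset /=; last by move=> s s' _ _; apply: double_perm_inj.
  apply: eq_big => [s|s _]; first by rewrite inE.
  rewrite double_perm_sign expr0 mul1r prodE !mxE !eqxx mulr1.
  apply: eq_bigr => i _; rewrite double_perm_even double_perm_odd /weight.
  by rewrite odd_evenI evenK eqxx.
(* If the product is nonzero, so is every weight, and this gives the conditions of
   [double_permP]. *)
rewrite prodE; have [|w0] := eqVneq (\prod_i weight i (t (evenI i)) (t (oddI i))) 0.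
  by move=> ->; rewrite scale0r mulr0 mxE.
have w_nz i : ~~ odd (t (evenI i)) && (t (oddI i) == oddI (halfI (t (evenI i)))).
  have /prodf_neq0/(_ i isT) := w0; rewrite /weight.
  by case: ifP => //; rewrite eqxx.
have [||s ts] := @double_permP n t.
- by move=> i; have /andP[] := w_nz i.
- by move=> i; have /andP[_ /eqP] := w_nz i.
by case/imsetP: t_im; exists s.
Qed.
End Reduction.

(** * Positions in row-major codes *)

Section Codes.

Lemma nth_flatten_const (T : Type) (x0 : T) (ss : seq (seq T)) m q k :
  all (fun s => size s == m) ss -> (k < m)%N ->
  nth x0 (flatten ss) (q * m + k) = nth x0 (nth [::] ss q) k.
Proof.
move=> + lt_km; elim: ss q => [|s ss IHss] q /=; first by rewrite !nth_nil.
move=> /andP[/eqP size_s ss_m]; rewrite nth_cat size_s.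
case: q => [|q]; first by rewrite add0n lt_km.
by rewrite ltnNge mulSn -addnA leq_addr /= addKn IHss.
Qed.

Variables (F : eqType) (T : Type) (code : T -> seq F) (m : nat).
Hypothesis size_code : forall x, size (code x) = m.

Lemma size_mx_code n (A : 'M[T]_n) : size (mx_code code A) = (n * n * m)%N.
Proof.
have /all_pred1P shapeE :
    all (pred1 m) (shape [seq code (A i j) | i <- enum 'I_n, j <- enum 'I_n]).
  by rewrite all_map; apply/allP => s /allpairsP[ij [_ _ ->]]; rewrite /= size_code.
rewrite size_flatten shapeE sumn_nseq size_map size_allpairs size_enum_ord.
exact: mulnC.
Qed.

Lemma nth_mx_code x0 n (A : 'M[T]_n) (i j : 'I_n) k : (k < m)%N ->
  nth x0 (mx_code code A) ((i * n + j) * m + k) = nth x0 (code (A i j)) k.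
Proof.
move=> lt_km; rewrite nth_flatten_const //; last first.
  by apply/allP => s /allpairsP[ij [_ _ ->]]; rewrite size_code.
congr (nth x0 _ k); rewrite nth_flatten_const //; last first.
  by apply/allP => s /mapP[i' _ ->]; rewrite size_map size_enum_ord.
by rewrite (nth_map i) ?size_enum_ord // (nth_map j) ?size_enum_ord // !nth_ord_enum.
Qed.

End Codes.

(** * Mixed-radix addresses of entries of blocks *)

Section Addresses.
Variables n S : nat.

(* The address of entry [(u, v)] of block [(r, c)] in the code of a 2n x 2n
   matrix of S x S blocks. *)
Definition addr (r c u v : nat) : nat := ((r * (2 * n) + c) * (S * S) + (u * S + v))%N.

Lemma eqn_divmod m q q' k k' : (k < m)%N -> (k' < m)%N ->
  (q * m + k == q' * m + k')%N = (q == q') && (k == k').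
Proof.
move=> lt_k lt_k'; apply/eqP/andP => [eq_qk | [/eqP-> /eqP->] //].
have m_gt0 := leq_ltn_trans (leq0n k) lt_k; split; apply/eqP.
  have := congr1 (divn^~ m) eq_qk.
  by rewrite !divnMDl // !divn_small // !addn0.
by have := congr1 (modn^~ m) eq_qk; rewrite !modnMDl !modn_small.
Qed.

Lemma ltn_divmod m p q k : (q < p)%N -> (k < m)%N -> (q * m + k < p * m)%N.
Proof. by move=> lt_q lt_k; nia. Qed.

Lemma eq_addr r r' c c' u u' v v' :
  (c < 2 * n)%N -> (c' < 2 * n)%N -> (u < S)%N -> (u' < S)%N ->
  (v < S)%N -> (v' < S)%N ->
  (addr r c u v == addr r' c' u' v') =
  [&& r == r', c == c', u == u' & v == v'].
Proof. by move=> *; rewrite !eqn_divmod ?ltn_divmod // -andbA. Qed.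

Lemma ltn_addr r c u v :
  (r < 2 * n)%N -> (c < 2 * n)%N -> (u < S)%N -> (v < S)%N ->
  (addr r c u v < 2 * n * (2 * n) * (S * S))%N.
Proof. by move=> *; rewrite !ltn_divmod. Qed.

Variant addr_spec : nat -> Type :=
  | AddrOf (r c : 'I_(2 * n)) (u v : 'I_S) : addr_spec (addr r c u v).

Lemma addrP x : (x < 2 * n * (2 * n) * (S * S))%N -> addr_spec x.
Proof.
move=> lt_x.
have m_gt0 : (0 < 2 * n)%N by case: (n) lt_x.
have S_gt0 : (0 < S)%N by case: (S) lt_x => //; rewrite !muln0.
have SS_gt0 : (0 < S * S)%N by rewrite muln_gt0 S_gt0.
have lt_rc : (x %/ (S * S) < 2 * n * (2 * n))%N by rewrite ltn_divLR.
have lt_r : (x %/ (S * S) %/ (2 * n) < 2 * n)%N by rewrite ltn_divLR.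
have lt_c : (x %/ (S * S) %% (2 * n) < 2 * n)%N by rewrite ltn_mod.
have lt_u : (x %% (S * S) %/ S < S)%N by rewrite ltn_divLR // ltn_mod.
have lt_v : (x %% (S * S) %% S < S)%N by rewrite ltn_mod.
have -> : x = addr (Ordinal lt_r) (Ordinal lt_c) (Ordinal lt_u) (Ordinal lt_v).
  by rewrite /addr /= -!divn_eq.
by constructor.
Qed.

(* For l = i n + j, the places in the code of B of A(i, j) and of the entry 1 of
   the block E_{j 0} in row 2i+1 and column 2j+1. *)
Definition fst_addr l := addr (l %/ n).*2 (l %% n).*2 0 (l %% n).
Definition snd_addr l := addr (l %/ n).*2.+1 (l %% n).*2.+1 (l %% n) 0.

End Addresses.

(** * The code of the block matrix as a scattered copy of the input *)

Section CodeOfReduction.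
Variables (F : fieldType) (n S : nat).
Hypotheses (n_gt0 : (0 < n)%N) (le_nS : (n <= S)%N).
Variable A : 'M[F]_n.

Lemma size_scalar_mx_code k (M : 'M[F]_k) :
  size (mx_code (@scalar_code F) M) = (k * k)%N.
Proof. by rewrite (@size_mx_code _ _ _ 1) ?muln1. Qed.

Lemma nth_scalar_mx_code k (M : 'M[F]_k) (i j : 'I_k) :
  nth 0 (mx_code (@scalar_code F) M) (i * k + j) = M i j.
Proof.
by have := @nth_mx_code _ _ (@scalar_code F) 1 (fun=> erefl) 0 k M i j 0 isT;
   rewrite muln1 addn0.
Qed.

Let S2_gt0 : (0 < S * S)%N.
Proof. by rewrite muln_gt0 andbb (leq_trans n_gt0). Qed.

(** With [l = i n + j], the address is [(4 i n + 2 j) S^2 + j], whose two summands bound [i n] and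
    [j]. *)
Lemma leq_fst_addr l : (l <= fst_addr n S l)%N.
Proof.
rewrite {1}(divn_eq l n) /fst_addr /addr leq_add //.
by apply: leq_trans (leq_pmulr _ S2_gt0); move: (l %/ n)%N (l %% n)%N => q j; nia.
Qed.

Lemma leq_snd_addr l : (l <= snd_addr n S l)%N.
Proof.
rewrite {1}(divn_eq l n) /snd_addr /addr (leq_trans _ (leq_addr _ _)) //.
by apply: leq_trans (leq_pmulr _ S2_gt0); move: (l %/ n)%N (l %% n)%N => q j; nia.
Qed.

(** Turns one entry into a sum over [k] that can be compared termwise with the one in [scatter]. *)
Lemma sum_pick N k0 (f : nat -> F) : (k0 < N)%N ->
  \sum_(0 <= k < N) f k *+ (k == k0) = f k0.
Proof.
move=> lt_k0; rewrite big_mkord (bigD1 (Ordinal lt_k0)) //= eqxx big1 ?addr0 //.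
by move=> k; rewrite -val_eqE => /negbTE /= ->.
Qed.

Lemma code_reduction_mx :
  nth 0 (mx_code (mx_code (@scalar_code F) (n:=S)) (reduction_mx n_gt0 le_nS A)) =1
  scatter (nth 0 (mx_code (@scalar_code F) A))
    (fst_addr n S) (snd_addr n S) (n * n) 0.
Proof.
set a := nth 0 (mx_code _ A); move=> x; rewrite /scatter /= add0r.
have divn_lt k : (k < n * n)%N -> (k %/ n < n)%N by rewrite ltn_divLR.
have modn_lt k : (k %% n < n)%N by rewrite ltn_mod.
have [le_x|lt_x] := leqP (2 * n * (2 * n) * (S * S)) x.
  (* Past the end of the code both sides are 0, since all target addresses lie within it. *)
  rewrite nth_default; last first.
    by rewrite (@size_mx_code _ _ _ (S * S)) //; apply: size_scalar_mx_code.
  rewrite big_nat big1 // => k /andP[_ /divn_lt lt_kn].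
  have lt_k := modn_lt k.
  rewrite !gtn_eqF ?mulr0n ?addr0 //;
    apply: leq_trans le_x; apply: ltn_addr; lia.
case: (addrP lt_x) => r c u v {x lt_x}.
rewrite (@nth_mx_code _ _ _ (S * S)); first last.
- exact: ltn_divmod.
- exact: size_scalar_mx_code.
rewrite nth_scalar_mx_code mxE big_split /=.
have fstE k : (addr n S r c u v == fst_addr n S k) =
    [&& (r : nat) == (k %/ n).*2, (c : nat) == (k %% n).*2,
        (u : nat) == 0 & (v : nat) == k %% n]%N.
  have lt_k := modn_lt k; apply: eq_addr => //; lia.
have sndE k : (addr n S r c u v == snd_addr n S k) =
    [&& (r : nat) == (k %/ n).*2.+1, (c : nat) == (k %% n).*2.+1,
        (u : nat) == k %% n & (v : nat) == 0]%N.
  have lt_k := modn_lt k; apply: eq_addr => //; lia.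
under eq_bigr do rewrite fstE; under [X in _ + X]eq_bigr do rewrite sndE.
have odd_neq p q : (p.*2.+1 == q.*2) = false by apply/negP; lia.
have even_neq p q : (p.*2 == q.*2.+1) = false by apply/negP; lia.
have pickE (i j : 'I_n) (k : nat) :
    (k == i * n + j)%N = ((i : nat) == k %/ n)%N && ((j : nat) == k %% n)%N.
  by rewrite {1}(divn_eq k n) eqn_divmod // (eq_sym (k %/ n)%N) (eq_sym (k %% n)%N).
have lt_pick (i j : 'I_n) : (i * n + j < n * n)%N by apply: ltn_divmod.
(* Even-even blocks meet only the first sum, odd-odd blocks only the second, mixed blocks
   neither. *)
case: (parityP r) => i; case: (parityP c) => j;
  rewrite ?odd_evenI ?odd_oddI /=; rewrite ?evenK ?oddK.
- rewrite [X in _ + X]big1 ?addr0; last by move=> k _; rewrite even_neq.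
  rewrite !mxE -(nth_scalar_mx_code A) -/a -(sum_pick a (lt_pick i j)) mulr_suml.
  apply: eq_bigr => k _; rewrite mulr_natr -mulrnA mulnb pickE.
  congr (_ *+ nat_of_bool _); rewrite !(inj_eq double_inj) -!val_eqE /=.
  by case: (_ =P k %/ n)%N => //= _; case: (_ =P k %% n)%N => //= <-.
- rewrite mxE !big1 ?addr0 // => k _; first by rewrite even_neq.
  by rewrite odd_neq andbF.
- rewrite mxE !big1 ?addr0 // => k _; last by rewrite odd_neq.
  by rewrite even_neq andbF.
rewrite big1 ?add0r; last by move=> k _; rewrite odd_neq.
rewrite mxE; set w := (_ && _)%:R; rewrite -(sum_pick (fun=> w) (lt_pick i j)) {}/w.
apply: eq_bigr => k _; rewrite -mulrnA mulnb pickE.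
congr (nat_of_bool _)%:R; rewrite !eqSS !(inj_eq double_inj) -!val_eqE /= andbC.
by case: (_ =P k %/ n)%N => //= _; case: (_ =P k %% n)%N => //= <-.
Qed.

End CodeOfReduction.

(** * The program that builds the code of the block matrix *)

Section Program.
Variable F : fieldType.

(* Registers: 0 holds n, 1 holds n^2 (= S), 2 holds S^2, 3 holds n S^2 and
   4 holds n S; 5 and 6 are the loop counters i and j, and 7 to 10 hold
   i n S^2, i n, j S^2 and j S. *)
Definition reg_list (n S i j : nat) : seq nat :=
  [:: n; S; S * S; n * (S * S); n * S; i; j;
      i * (n * (S * S)); i * n; j * (S * S); j * S]%N.

Definition NTwice e := NAdd e e.
Definition src_exp := NAdd (NReg 8) (NReg 6).
(** This is [4 i n S^2 + 2 j S^2 + j], formed by doubling since expressions have no multiplication;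
    likewise [snd_exp] is [(2 i + 1) 2 n S^2 + (2 j + 1) S^2 + j S]. *)
Definition fst_exp :=
  NAdd (NAdd (NTwice (NTwice (NReg 7))) (NTwice (NReg 9))) (NReg 6).
Definition snd_exp :=
  NAdd (NAdd (NTwice (NTwice (NReg 7))) (NAdd (NTwice (NReg 3)) (NReg 2)))
       (NAdd (NTwice (NReg 9)) (NReg 10)).

(** The counters go down first, so that the addresses are those of the entry to be moved. *)
Definition move_entry : cmd F :=
  Seq (SetReg 6 (NSub (NReg 6) (NConst 1)))
 (Seq (SetReg 9 (NSub (NReg 9) (NReg 2)))
 (Seq (SetReg 10 (NSub (NReg 10) (NReg 1)))
 (Seq (If (BLt src_exp fst_exp)
        (Seq (SetMem fst_exp (FAdd (FMem fst_exp) (FMem src_exp)))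
             (SetMem src_exp (FConst 0)))
        Skip)
      (SetMem snd_exp (FAdd (FMem snd_exp) (FConst 1)))))).

Definition move_row : cmd F :=
  Seq (SetReg 5 (NSub (NReg 5) (NConst 1)))
 (Seq (SetReg 7 (NSub (NReg 7) (NReg 3)))
 (Seq (SetReg 8 (NSub (NReg 8) (NReg 0)))
 (Seq (SetReg 6 (NReg 0))
 (Seq (SetReg 9 (NReg 3))
 (Seq (SetReg 10 (NReg 4))
      (While (BLt (NConst 0) (NReg 6)) move_entry)))))).

(** Register 5 is scratch until it receives [n]. Registers 7 and 8 are set for [i = n], while 6, 9
    and 10 stay 0 for [j = 0]. *)
Definition set_up : cmd F :=
  Seq (SetMul F 1 0 0 5)
 (Seq (SetMul F 2 1 1 5)
 (Seq (SetMul F 3 2 0 5)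
 (Seq (SetMul F 4 1 0 5)
 (Seq (SetMul F 7 3 0 5)
 (Seq (SetMul F 8 0 0 5)
      (SetReg 5 (NReg 0))))))).

(** The determinant program expects only register 0 to be nonzero; the loops leave 0 in registers 5
    to 10. *)
Definition clean_up : cmd F :=
  Seq (SetReg 1 (NConst 0))
 (Seq (SetReg 2 (NConst 0))
 (Seq (SetReg 3 (NConst 0))
      (SetReg 4 (NConst 0)))).

Definition reduction : cmd F :=
  Seq set_up (Seq (While (BLt (NConst 0) (NReg 5)) move_row) clean_up).

Lemma runs_SetMul d a b c rs (M : nat -> F) : d != c -> a != c -> a != d ->
  runs (SetMul F d a b c) (listing rs M)
    (listing (set_nth 0%N (set_nth 0%N (set_nth 0%N rs c (nth 0 rs b)) c 0) d
       (nth 0 rs d + nth 0 rs b * nth 0 rs a))%N M)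
    (1 + (nth 0%N rs b * 3 + 1)).
Proof.
move=> dc ac ad; apply: runs_seq; first exact: runs_SetReg.
have := runs_AddMul (set_nth 0%N rs c (nth 0%N rs b)) M dc ac ad.
by rewrite !nth_set_nth /= (negbTE dc) (negbTE ac) eqxx.
Qed.

Variable n : nat.
Hypothesis n_gt0 : (0 < n)%N.
Let S := (n * n)%N.

Lemma runs_set_up (M : nat -> F) :
  runs set_up (listing [:: n] M) (listing (reg_list n S n 0) M) (20 * S + 20).
Proof.
have leS : (n <= S)%N by rewrite leq_pmulr.
pose rs1 := [:: n; S; 0; 0; 0; 0]%N.
pose rs2 := [:: n; S; S * S; 0; 0; 0]%N.
pose rs3 := [:: n; S; S * S; n * (S * S); 0; 0]%N.
pose rs4 := [:: n; S; S * S; n * (S * S); n * S; 0]%N.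
pose rs5 := rs4 ++ [:: 0; n * (n * (S * S))]%N.
pose rs6 := rcons rs5 (n * n)%N.
pose T m := (1 + (m * 3 + 1))%N.
apply: (@runs_le _ _ _ _ (T n + (T S + (T n + (T n + (T n + (T n + 1))))))%N).
  by rewrite /T; lia.
apply: (@runs_seq _ _ _ _ (listing rs1 M)); first exact: (@runs_SetMul 1 0 0 5 [:: n]).
apply: (@runs_seq _ _ _ _ (listing rs2 M)); first exact: (@runs_SetMul 2 1 1 5 rs1).
apply: (@runs_seq _ _ _ _ (listing rs3 M)); first exact: (@runs_SetMul 3 2 0 5 rs2).
apply: (@runs_seq _ _ _ _ (listing rs4 M)); first exact: (@runs_SetMul 4 1 0 5 rs3).
apply: (@runs_seq _ _ _ _ (listing rs5 M)); first exact: (@runs_SetMul 7 3 0 5 rs4).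
apply: (@runs_seq _ _ _ _ (listing rs6 M)); first exact: (@runs_SetMul 8 0 0 5 rs5).
have := @runs_SetReg _ 5 (NReg 0) rs6 M.
congr (runs _ _ _ _); apply: eq_listing => // x.
by do 11?[case: x => [|x] //]; rewrite /= ?nth_nil.
Qed.

Variable a : nat -> F.
Let M l := scatter a (fst_addr n S) (snd_addr n S) (n * n) l.

(** The 7 steps are three decrements, a test with at most two assignments, and the final
    assignment. *)
Lemma runs_move_entry i j : (i < n)%N -> (j < n)%N ->
  runs move_entry (listing (reg_list n S i j.+1) (M (i * n + j.+1)))
    (listing (reg_list n S i j) (M (i * n + j))) 7.
Proof.
move=> lt_in lt_jn.
have S_gt0 : (0 < S)%N by rewrite muln_gt0 n_gt0.
pose l := (i * n + j)%N.
have lt_l : (l < n * n)%N by apply: ltn_divmod.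
have divl : (l %/ n = i)%N by rewrite divnMDl // divn_small ?addn0.
have modl : (l %% n = j)%N by rewrite modnMDl modn_small.
have leS : (n <= S)%N by rewrite leq_pmulr.
have leD := leq_fst_addr n_gt0 leS.
have leE := leq_snd_addr n_gt0 leS.
have srcE N : neval (listing (reg_list n S i j) N) src_exp = l by [].
have fstE N : neval (listing (reg_list n S i j) N) fst_exp = fst_addr n S l.
  by rewrite /= /fst_addr /addr divl modl; nia.
have sndE N : neval (listing (reg_list n S i j) N) snd_exp = snd_addr n S l.
  by rewrite /= /snd_addr /addr divl modl; nia.
rewrite addnS -/l.
apply: (@runs_seq _ _ _ _ _ _ 1 6); first exact: runs_SetReg.
apply: (@runs_seq _ _ _ _ _ _ 1 5); first exact: runs_SetReg.
apply: (@runs_seq _ _ _ _ _ _ 1 4); first exact: runs_SetReg.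
set st := listing _ _.
have -> : st = listing (reg_list n S i j) (M l.+1).
  by apply: eq_listing => // x; rewrite /reg_list /= subn1 !mulSn !addKn.
apply: (@runs_seq _ _ _ _ (listing (reg_list n S i j)
  (moved a (fst_addr n S) (snd_addr n S) (n * n) l)) _ 3 1).
  apply: (@runs_If _ _ _ _ _ _ 2).
    rewrite /beval srcE fstE => lt_lD.
    rewrite (functional_extensionality _ _ (moved_lt a _ leD leE lt_lD)).
    have := runs_SetMem fst_exp (FAdd (FMem fst_exp) (FMem src_exp))
      (reg_list n S i j) (M l.+1).
    rewrite fstE /feval fstE srcE => /runs_seq; apply.
    exact: (runs_SetMem src_exp (FConst 0) (reg_list n S i j)).
  rewrite /beval srcE fstE => /(moved_ge a (snd_addr n S) (n * n) leD).
  by move=> /functional_extensionality ->; exists 1%N => //; constructor.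
have := runs_SetMem snd_exp (FAdd (FMem snd_exp) (FConst 1)) (reg_list n S i j).
move=> /(_ F (moved a (fst_addr n S) (snd_addr n S) (n * n) l)).
congr (runs _ _ _ _); apply: eq_listing => // x.
rewrite sndE /feval sndE /M scatter_step //=.
by case: eqP => [->|]; rewrite ?addr0.
Qed.

Lemma runs_move_row i : (i < n)%N ->
  runs move_row (listing (reg_list n S i.+1 0) (M (i.+1 * n)))
    (listing (reg_list n S i 0) (M (i * n))) (8 * n + 7).
Proof.
move=> lt_in; eapply runs_le; last first.
  eapply runs_seq; first exact: runs_SetReg.
  eapply runs_seq; first exact: runs_SetReg.
  eapply runs_seq; first exact: runs_SetReg.
  eapply runs_seq; first exact: runs_SetReg.
  eapply runs_seq; first exact: runs_SetReg.
  eapply runs_seq; first exact: runs_SetReg.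
  set st := listing _ _.
  (* The inner loop starts from [j = n], where [i n + n = (i + 1) n]. *)
  have -> : st = listing (reg_list n S i n) (M (i * n + n)).
    apply: eq_listing => [x|x]; last by rewrite mulSnr.
    by rewrite /reg_list /= subn1 !mulSn !addKn.
  have M0 : M (i * n) = M (i * n + 0) by rewrite addn0.
  rewrite M0.
  apply: (runs_while (st := fun j => listing (reg_list n S i j) (M (i * n + j)))) => //.
  by move=> j; apply: runs_move_entry.
by rewrite /=; lia.
Qed.

Lemma runs_reduction :
  runs reduction (listing [:: n] (M (n * n))) (listing [:: n] (M 0))
    (50 * S + 50).
Proof.
have leS : (n <= S)%N by rewrite leq_pmulr.
eapply runs_le; last first.
  eapply runs_seq; first exact: runs_set_up.
  eapply runs_seq.
    apply: (runs_while (st := fun i => listing (reg_list n S i 0) (M (i * n)))) => //.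
    by move=> i; apply: runs_move_row.
  eapply runs_seq; first exact: runs_SetReg.
  eapply runs_seq; first exact: runs_SetReg.
  eapply runs_seq; first exact: runs_SetReg.
  have := runs_SetReg 4 (NConst 0).
  move=> /(_ F); set rs := (X in listing X _); move=> /(_ rs (M 0)).
  congr (runs _ _ _ _); apply: eq_listing => // x.
  by rewrite /rs /reg_list /=; do 12?[case: x => [|x] //=]; rewrite !nth_nil.
rewrite -/S in leS *; nia.
Qed.

End Program.

(** * Polynomial time bounds and the composed algorithm *)

(** For [m >= 2] the factor is absorbed by [C < m ^ C], for [m = 1] by the summand [k]. *)
Lemma poly_bound (C d : nat) :
  exists k, forall m, (0 < m)%N -> (C * m ^ d <= m ^ k + k)%N.
Proof.
exists (d + C)%N => -[//|[_|m _]]; first by rewrite !exp1n; lia.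
rewrite expnD mulnC (leq_trans _ (leq_addr _ _)) // leq_mul //.
by rewrite ltnW // ltn_expl.
Qed.

Lemma init_listing (F : fieldType) n (w : seq F) (M : nat -> F) :
  nth 0 w =1 M -> init n w = listing [:: n] M.
Proof.
move=> /functional_extensionality wM; rewrite /init /listing wM; congr State.
by apply: functional_extensionality => -[|[]].
Qed.

Theorem theorem4p6 (F : fieldType) :
  exists c : nat, (0 < c)%N /\
    (Cdet_polytime F (fun n : nat => (c * n ^ 2)%N) -> permanent_polytime F).
Proof.
exists 1%N; split=> // -[p [k p_Cdet]].
(* For [m = n^2] the new instance has [4 m^3] field elements, so [p] takes at most [4^k m^(3k) + k]
   steps, after at most [50 m + 50] for the reduction. *)
have [K leK] := poly_bound (100 + 4 ^ k + k) (3 * k).+1.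
exists (Seq (reduction F) p), K => n n_gt0 A.
have eqS : (1 * n ^ 2 = n * n)%N by rewrite mul1n -mulnn.
have n2_gt0 : (0 < n * n)%N by rewrite muln_gt0 n_gt0.
have le_nS : (n <= 1 * n ^ 2)%N by rewrite eqS leq_pmulr.
pose S2 := (1 * n ^ 2 * (1 * n ^ 2))%N.
have [t [s [p_exec p_time p_out]]] := p_Cdet n n_gt0 (reduction_mx n_gt0 le_nS A).
set a := nth 0 (mx_code (@scalar_code F) A).
have [t' le_t' r_exec] := runs_reduction n_gt0 a.
exists (t' + t)%N, s; split.
- apply: ExecSeq (_ : exec _ (init _ _) _ (init _ _)) p_exec.
  rewrite (init_listing n (code_reduction_mx n_gt0 le_nS A)) eqS.
  pose N := (n * n)%N.
  (* At first all sources are in place and the sum in [scatter] is empty. *)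
  rewrite (@init_listing _ _ _ (scatter a (fst_addr n N) (snd_addr n N) N N)) //.
  move=> x; rewrite /scatter big_geq // addr0; case: ltnP => // le_x.
  by rewrite nth_default ?size_scalar_mx_code.
- move: p_time; rewrite (@size_mx_code _ _ _ S2); last first.
    by move=> C; rewrite size_scalar_mx_code.
  rewrite size_scalar_mx_code => p_time; apply: leq_trans (leK _ n2_gt0).
  move: p_time le_t'; rewrite /S2 eqS.
  have -> : (2 * n * (2 * n) * (n * n * (n * n)) = 4 * (n * n) ^ 3)%N.
    by rewrite !expnS expn0; lia.
  rewrite expnMn -expnM expnS.
  set m := (n * n)%N in n2_gt0 *; have := leq_pexp2l n2_gt0 (leq0n (3 * k)).
  set q := (m ^ (3 * k))%N; set r := (4 ^ k)%N; rewrite expn0.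
  by clearbody m q r; nia.
(* The output is one scalar at position 0, where the code of the determinant has its entry (0,
   0). *)
case=> // _; rewrite -(Cdet_reduction_mx n_gt0 le_nS) p_out; last first.
  by rewrite size_scalar_mx_code eqS muln_gt0 n2_gt0.
set o := widen_ord _ _.
by rewrite -(nth_scalar_mx_code (Cdet _) o o).
Qed.
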